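(* Let $n\geq 3$ and $k\geq 1$ be integers, let $K$ be a field, and let $R=K[V(T_{n,k})]$. Then the Krull dimension of $R/I(T_{n,k})$ is $$\dim(R/I(T_{n,k}))=\frac{(n-1)^{k+1}-1}{n-2}.$$
   Context: For a finite simple graph $G$, $K[V(G)]$ denotes the polynomial ring over $K$ whose variables are the vertices of $G$, and the edge ideal $I(G)\subset K[V(G)]$ is the ideal generated by the monomials $xy$ with $\{x,y\}$ an edge of $G$. Perfect semiregular tree $T_{n,k}$: the rooted tree in which all non-pendant vertices (vertices of degree $\neq 1$) have degree $n$ and all pendant vertices (leaves) are at distance $k$ from the root. Explicitly, the root has $n$ children, every other non-leaf vertex has exactly $n-1$ children, and all leaves are at distance $k$ from the root. *)

(* Defs.v *)
From HB Require Import structures.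
From mathcomp Require Import all_boot all_order all_algebra ring_quotient boolp.
From mathcomp Require Import mpoly.

Set Implicit Arguments.
Unset Strict Implicit.
Unset Printing Implicit Defensive.

Import GRing.Theory.
Local Open Scope ring_scope.

Definition proper_subpred (T : Type) (P Q : {pred T}) : Prop :=
  {subset P <= Q} /\ exists2 x, x \in Q & x \notin P.

(* [prime_idealr A] consists of boolean predicates; under the classical axioms
   of [boolp] these are all the prime ideals of [A]. The chain
   P_0 < P_1 < ... < P_d has length d. *)
Definition prime_chain (A : comNzRingType) (d : nat)
    (P : 'I_d.+1 -> prime_idealr A) : Prop :=
  forall i j : 'I_d.+1, (i < j)%N -> proper_subpred (P i) (P j).

Definition has_krull_dim (A : comNzRingType) (d : nat) : Prop :=
  (exists P : 'I_d.+1 -> prime_idealr A, prime_chain P) /\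
  (forall (e : nat) (P : 'I_e.+1 -> prime_idealr A),
     prime_chain P -> (e <= d)%N).

Definition ideal_gen (R : comNzRingType) (S : R -> Prop) : {pred R} :=
  fun p => `[< exists s : seq (R * R),
    (forall c, c \in s -> S c.2) /\ p = \sum_(c <- s) c.1 * c.2 >].

Record sgraph : Type := SGraph {
  vertex :> finType;
  adj : rel vertex;
  adj_sym : ssrbool.symmetric adj;
  adj_irr : irreflexive adj
}.

Definition vertex_ring (K : fieldType) (G : sgraph) : comNzRingType :=
  {mpoly K[#|G|]}.

Definition vertex_var (K : fieldType) (G : sgraph) (v : G) : vertex_ring K G :=
  'X_(enum_rank v).

Definition edge_ideal (K : fieldType) (G : sgraph) : {pred vertex_ring K G} :=
  ideal_gen (fun p : vertex_ring K G =>
    exists x y : G, adj x y /\ p = vertex_var K x * vertex_var K y).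

Lemma edge_ideal_closed (K : fieldType) (G : sgraph) :
  idealr_closed (@edge_ideal K G).
Proof.
split.
- by apply/asboolP; exists [::]; split => //; rewrite big_nil.
- apply/asboolP => -[s [sS]] /(congr1 (meval (fun=> 0))) /eqP.
  rewrite rmorph1 rmorph_sum big_seq big1 ?oner_eq0 // => c /sS [x [y [_ ->]]].
  by rewrite !rmorphM /= mevalXU mul0r mulr0.
- move=> a u v /asboolP[s [sS ->]] /asboolP[t [tS ->]]; apply/asboolP.
  exists ([seq (a * c.1, c.2) | c <- s] ++ t); split.
    move=> c; rewrite mem_cat => /orP[/mapP[b bs ->]|]; last exact: tS.
    exact: sS bs.
  rewrite big_cat big_map mulr_sumr; congr (_ + _).
  by apply: eq_bigr => c _; rewrite mulrA.
Qed.

HB.instance Definition _ (K : fieldType) (G : sgraph) :=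
  isIdealr.Build (vertex_ring K G) (@edge_ideal K G)
    (@edge_ideal_closed K G).

Definition edge_ring (K : fieldType) (G : sgraph) : comNzRingType :=
  {ideal_quot (@edge_ideal K G)}.

(* A vertex is the word of child indices read from the root [::] down to it:
   the first letter is one of n choices, every later letter one of n - 1, and
   the leaves are the words of length k. *)
Definition tree_vertex (n k : nat) : finType :=
  {w : k.-bseq 'I_n | all (fun i : 'I_n => (i < n.-1)%N) (behead w)}.

Definition tree_word (n k : nat) (v : tree_vertex n k) : seq 'I_n := val v.

Definition child_of (n k : nat) (v w : tree_vertex n k) : bool :=
  (size (tree_word w) == (size (tree_word v)).+1)
  && prefix (tree_word v) (tree_word w).

Definition tree_adj (n k : nat) : rel (tree_vertex n k) :=
  fun v w => child_of v w || child_of w v.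

Lemma tree_adj_sym (n k : nat) : ssrbool.symmetric (@tree_adj n k).
Proof. by move=> v w; rewrite /tree_adj orbC. Qed.

Lemma tree_adj_irr (n k : nat) : irreflexive (@tree_adj n k).
Proof. by move=> v; rewrite /tree_adj /child_of ltn_eqF. Qed.

Definition semiregular_tree (n k : nat) : sgraph :=
  SGraph (@tree_adj_sym n k) (@tree_adj_irr n k).

(* The truncated division in the dimension formula is exact. *)
Fact tree_dim_dvd (n k : nat) :
  (2 < n)%N -> (n - 2 %| (n - 1) ^ k.+1 - 1)%N.
Proof.
move=> n2; have := dvdn_pred_predX (n - 1) k.+1.
by rewrite -!subn1 -subnDA.
Qed.

(* Main.v *)
(* The dimension of an edge ring is the independence number of the graph.

   Lower bound: for an independent set S, killing the variables outside S and
   then those of S one at a time gives a chain of length #|S|.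

   Upper bound: let P_0 < ... < P_e be a chain and f_i in P_(i+1) minus P_i. A
   nontrivial polynomial relation between f_0, ..., f_(e-1) modulo P_0 is
   impossible: its lowest power of f_0 can be cancelled, its leading part is a
   relation between f_1, ..., f_(e-1) modulo P_1, and so on, until a nonzero
   constant lies in P_e. On the other hand the variables outside P_0 form an
   independent set S, and if e > #|S| a relation exists by counting monomials.

   In the tree, the levels of the parity of k form a maximum independent set. *)
From HB Require Import structures.
Require Import Defs.
From mathcomp Require Import all_boot all_order all_algebra.
From mathcomp Require Import generic_quotient ring_quotient boolp mpoly.

Set Implicit Arguments.
Unset Strict Implicit.
Unset Printing Implicit Defensive.

Import GRing.Theory.
Local Open Scope ring_scope.
Local Open Scope quotient_scope.

(** * Independence of elements chosen along a chain of primes *)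

Lemma big_tuple_cons (V : nmodType) (T : finType) (l : nat)
    (F : l.+1.-tuple T -> V) :
  \sum_t F t = \sum_(a : T) \sum_(t : l.-tuple T) F [tuple of a :: t].
Proof.
rewrite pair_big /= (reindex (fun p : T * l.-tuple T => [tuple of p.1 :: p.2])) //.
exists (fun t => (thead t, [tuple of behead t])) => [[a t]|t] _ /=.
  by congr (_, _); apply: val_inj.
by rewrite [RHS]tuple_eta.
Qed.

Lemma sum_pow_ge (A : comNzRingType) (D k : nat) (g : 'I_D -> A) (x : A) :
  (forall a : 'I_D, (a < k)%N -> g a = 0) ->
  \sum_(a < D) x ^+ a * g a = x ^+ k * \sum_(a < D) x ^+ (a - k) * g a.
Proof.
move=> g0; rewrite mulr_sumr; apply: eq_bigr => a _.
by case: (ltnP a k) => [/g0 ->|ka]; rewrite ?mulr0 // mulrA -exprD subnKC.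
Qed.

(** A nonzero constant is sent to a unit, and a prime ideal is proper. *)
Lemma rmorph_prime_eq0 (K : fieldType) (A : comNzRingType)
    (phi : {rmorphism K -> A}) (P : prime_idealr A) (c : K) :
  phi c \in P -> c = 0.
Proof.
move=> cP; apply/eqP/negP => /negP c0; have := idealr1 P.
by rewrite -(rmorph1 phi) -(mulVf c0) rmorphM /= idealMr.
Qed.

(* Looking at the lowest power of [f 0] with a nonzero coefficient: it can be
   cancelled since [f 0 \notin P 0%N], and its coefficient then lies in [P 1]
   since [f 0 \in P 1]. *)
Lemma prime_chain_free (K : fieldType) (A : comNzRingType)
    (phi : {rmorphism K -> A}) (D l : nat) (P : nat -> prime_idealr A)
    (f : nat -> A) (c : l.-tuple 'I_D -> K) :
  (forall i, (i < l)%N ->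
     [/\ {subset P i <= P i.+1}, f i \notin P i & f i \in P i.+1]) ->
  \sum_(t : l.-tuple 'I_D) phi (c t) * \prod_(i < l) f i ^+ tnth t i \in P 0%N ->
  forall t, c t = 0.
Proof.
elim: l P f c => [|l IHl] P f c chainP sumP t.
  move: sumP; rewrite (bigD1 t) //= [X in _ + X]big1 => [|u]; last first.
    by rewrite [u]tuple0 [t]tuple0 eqxx.
  by rewrite addr0 big_ord0 mulr1 => /rmorph_prime_eq0.
have [subP f0P f0P1] := chainP 0%N isT.
pose g (a : 'I_D) := \sum_(t : l.-tuple 'I_D)
  phi (c [tuple of a :: t]) * \prod_(i < l) f i.+1 ^+ tnth t i.
have gP a : g a \in P 1%N -> forall t : l.-tuple _, c [tuple of a :: t] = 0.
  exact: IHl (fun i => P i.+1) (fun i => f i.+1) (fun t => c [tuple of a :: t])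
    (fun i => chainP i.+1).
have {sumP} sumP : \sum_(a < D) f 0%N ^+ a * g a \in P 0%N.
  move: sumP; rewrite big_tuple_cons => sumP.
  suff -> : \sum_(a < D) f 0%N ^+ a * g a = \sum_(a < D) \sum_(t : l.-tuple 'I_D)
     phi (c [tuple of a :: t]) * \prod_(i < l.+1) f i ^+ tnth [tuple of a :: t] i.
    exact: sumP.
  apply: eq_bigr => a _; rewrite mulr_sumr; apply: eq_bigr => u _.
  rewrite big_ord_recl tnth0 mulrCA; congr (_ * (_ * _)).
  by apply: eq_bigr => i _; rewrite tnthS.
suff c0 k (a : 'I_D) : a = k :> nat -> forall t : l.-tuple _, c [tuple of a :: t] = 0.
  by rewrite [t]tuple_eta (c0 (thead t)).
elim/ltn_ind: k a => k IHk a ak; apply: gP.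
have g0 (b : 'I_D) : (b < k)%N -> g b = 0.
  by move=> bk; rewrite /g big1 // => u _; rewrite (IHk b) // rmorph0 mul0r.
have powP j x : f 0%N ^+ j * x \in P 0%N -> x \in P 0%N.
  elim: j => [|j IHj]; first by rewrite mul1r.
  by rewrite exprS -mulrA prime_idealrM (negPf f0P) => /IHj.
move: sumP; rewrite (sum_pow_ge _ g0) => /powP/subP.
rewrite (bigD1 a) //= ak subnn mul1r rpredDr //.
apply: rpred_sum => b ba; have [/g0 -> | kb | bk] := ltngtP b k.
- by rewrite mulr0 rpred0.
- by rewrite -(subnSK kb) exprSr mulrC mulrA idealMr.
- by case/eqP: ba; apply: val_inj; rewrite /= bk ak.
Qed.

(** * Polynomial relations by counting monomials *)

Lemma mdeg_msupp_prod (K : fieldType) (N l D d : nat) (F : 'I_l -> {mpoly K[N]})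
    (t : l.-tuple 'I_D) (m : 'X_{1..N}) :
  (forall i, (msize (F i) <= d)%N) ->
  m \in msupp (\prod_(i < l) F i ^+ tnth t i) -> (mdeg m <= l * (D * d))%N.
Proof.
move=> dF; pose Q (p : {mpoly K[N]}) e := forall m, m \in msupp p -> (mdeg m <= e)%N.
have Q1 e : Q 1 e by move=> u; rewrite msupp1 inE => /eqP ->; rewrite mdeg0.
have QM p q a b : Q p a -> Q q b -> Q (p * q) (a + b)%N.
  move=> Qp Qq u /msuppM_le /allpairsP[[v w] /= [vp wq ->]].
  by rewrite mdegD leq_add ?Qp ?Qq.
have QX i j : Q (F i ^+ j) (j * d)%N.
  elim: j => [|j IHj]; first exact: Q1.
  rewrite exprS mulSn; apply: QM => // u /msize_mdeg_lt udeg.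
  exact: leq_trans (ltnW udeg) (dF i).
suff H : Q (\prod_(i < l) F i ^+ tnth t i) (\sum_(i < l) D * d)%N.
  by move=> /H; rewrite sum_nat_const card_ord.
apply: (big_ind2 Q) => [|p a q e|i _ u /QX ui]; [exact: Q1 | exact: QM |].
apply: leq_trans ui _.
by rewrite leq_mul2r ltnW ?orbT.
Qed.

(* Counting: at exponents below [D] there are [D ^ l] monomials in the [F i],
   while their coefficients at monomials supported on [S] are indexed by at most
   [(l * (D * d) + 1) ^ #|S|] multi-indices. *)
Lemma mpoly_supp_dependent (K : fieldType) (N l : nat) (S : {set 'I_N})
    (F : 'I_l -> {mpoly K[N]}) :
  (#|S| < l)%N ->
  exists D (c : l.-tuple 'I_D -> K), (exists t, c t != 0) /\
    forall m : 'X_{1..N}, (forall i, m i != 0%N -> i \in S) ->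
      (\sum_(t : l.-tuple 'I_D) c t *: \prod_(i < l) F i ^+ tnth t i)@_m = 0.
Proof.
move=> Sl; pose d := (\max_i msize (F i))%N; pose b := (l * d).+1.
(* [E + 1 <= D * b] and [b ^ #|S| < D] give [(E + 1) ^ #|S| <= D ^ #|S| * b ^ #|S| < D ^ (#|S| + 1)
   <= D ^ l]. *)
pose D := (b ^ #|S|).+1; pose E := (l * (D * d))%N; exists D.
have dF i : (msize (F i) <= d)%N by apply: leq_bigmax.
pose T := (l.-tuple 'I_D : finType).
(* Exponent vectors with entries at most [E], equal to the default 0 outside [S]. *)
pose J := {f : {ffun 'I_N -> 'I_E.+1} | f \in pffun_on ord0 (mem S) predT}.
have ltJT : (#|{: J}| < #|{: T}|)%N.
  rewrite card_sig card_pffun_on card_tuple !card_ord.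
  apply: (@leq_trans (D ^ #|S|.+1)); last exact: leq_pexp2l.
  rewrite expnS; apply: (@leq_ltn_trans ((D * b) ^ #|S|)).
    case: #|S| => // s; rewrite leq_exp2r // /E /b.
    by rewrite mulnCA mulnS -add1n leq_add2r.
  by rewrite expnMn mulnC ltn_pmul2r ?expn_gt0 // ltnS.
pose G (t : T) := \prod_(i < l) F i ^+ tnth t i.
pose mon (j : J) : 'X_{1..N} := [multinom (val j i : nat) | i < N].
pose M := \matrix_(a < #|{: T}|, j < #|{: J}|) (G (enum_val a))@_(mon (enum_val j)).
(* There are more rows than columns, so the left kernel is nonzero. *)
have /rowV0Pn[v /sub_kermxP vM v0] : kermx M != 0.
  by rewrite -mxrank_eq0 mxrank_ker subn_eq0 -ltnNge (leq_ltn_trans (rank_leq_col _)).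
exists (fun t => v 0 (enum_rank t)); split.
  have /rV0Pn[a va] := v0.
  by exists (enum_val a); rewrite enum_valK.
move=> m mS; rewrite raddf_sum /=.
(* By the degree bound, a monomial with an exponent above [E] occurs in none of the products. *)
have [/forallP mE|/forallPn[i mi]] := boolP [forall i, m i < E.+1]%N; last first.
  rewrite big1 // => t _; rewrite mcoeffZ.
  suff /eqP -> : (G t)@_m == 0 by rewrite mulr0.
  rewrite mcoeff_eq0; apply: contra mi => /(mdeg_msupp_prod dF); apply: leq_trans.
  by rewrite mdegE (bigD1 i) //= leq_addr.
pose f := [ffun i => Ordinal (mE i)].
have fJ : f \in pffun_on ord0 (mem S) predT.
  apply/pffun_onP; split=> [|i]; last by [].
  
  apply/subsetP => i; rewrite inE ffunE => fi; apply: mS.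
  by apply: contraNneq fi => mi; apply/eqP/val_inj.
have /rowP/(_ (enum_rank (Sub f fJ : J))) := vM; rewrite !mxE => vm0.
rewrite -[RHS]vm0 (reindex (@enum_val T predT)) /=; last first.
  exact/onW_bij/enum_val_bij.
apply: eq_bigr => a _; rewrite mcoeffZ !mxE enum_valK enum_rankK; congr (_ * _@__).
by apply/mnmP => i; rewrite mnmE ffunE.
Qed.

(** * Upper bound for the dimension of an edge ring *)

Definition independent (G : sgraph) (S : {set G}) : Prop :=
  {in S &, forall x y : G, ~~ adj x y}.

Lemma pi_edge_eq0 (K : fieldType) (G : sgraph) (x y : G) :
  adj x y -> \pi_(edge_ring K G) (vertex_var K x * vertex_var K y) = 0.
Proof.
move=> xy; rewrite -(rmorph0 \pi_(edge_ring K G)); apply/eqP.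
rewrite -Quotient.idealrBE subr0; apply/asboolP.
exists [:: (1, vertex_var K x * vertex_var K y)].
split=> [_ /[!inE] /eqP -> /=|]; first by exists x, y.
by rewrite big_seq1 mul1r.
Qed.

Lemma edge_ring_chain_le (K : fieldType) (G : sgraph) (d e : nat)
    (P : 'I_e.+1 -> prime_idealr (edge_ring K G)) :
  (forall S : {set G}, independent S -> (#|S| <= d)%N) ->
  prime_chain P -> (e <= d)%N.
Proof.
move=> indep_d chainP; rewrite leqNgt; apply/negP => de.
pose S := [set v : G | \pi_(edge_ring K G) (vertex_var K v) \notin P ord0].
have indepS : independent S.
  (* For an edge the product of the two variables is 0, so the prime [P ord0] contains one of
     them. *)
  move=> x y; rewrite !inE => xP yP; apply/negP => /(pi_edge_eq0 K) /= xy0.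
  have := idealr0 (P ord0); rewrite -[0]xy0 rmorphM prime_idealrM.
  by rewrite (negPf xP) (negPf yP).
pose P' i := P (inord i).
have [f fP] : exists f : nat -> edge_ring K G, forall i, (i < e)%N ->
    [/\ {subset P' i <= P' i.+1}, f i \notin P' i & f i \in P' i.+1].
  have /choice[f fP] : forall i, exists x : edge_ring K G, (i < e)%N ->
      [/\ {subset P' i <= P' i.+1}, x \notin P' i & x \in P' i.+1].
    move=> i; have [ie|_] := boolP (i < e)%N; last by exists 0.
    have [|subP [x x1 x0]] := chainP (inord i) (inord i.+1); last by exists x.
    by rewrite !inordK // ltnS ltnW.
  by exists f.
have cardS : (#|[set enum_rank v | v in S]| < e)%N.
  by rewrite (card_imset _ enum_rank_inj) (leq_ltn_trans (indep_d _ indepS)).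
have [D [c [[t ct0] cS]]] :=
  mpoly_supp_dependent (fun i : 'I_e => repr (f i) : {mpoly K[#|G|]}) cardS.
case/eqP: ct0.
pose phi : {rmorphism K -> edge_ring K G} := \pi_(edge_ring K G) \o @mpolyC #|G| K.
apply: (prime_chain_free (phi := phi) fP).
set Q := \sum_(t : _) _ in cS.
have -> : \sum_(t : e.-tuple 'I_D) phi (c t) * \prod_(i < e) f i ^+ tnth t i
    = \pi_(edge_ring K G) Q.
  rewrite raddf_sum; apply: eq_bigr => u _ /=.
  rewrite -mul_mpolyC rmorphM rmorph_prod; congr (_ * _).
  by apply: eq_bigr => i _; rewrite rmorphXn /= reprK.
have -> : P' 0%N = P ord0 by congr P; apply: val_inj; rewrite /= inordK.
(* [Q] has no monomial supported on [S]; any other monomial has a variable whose class lies in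
   [P ord0]. *)
rewrite [Q]mpolyE raddf_sum big_seq; apply: rpred_sum => m /= mQ.
have [/forallP mS|/forallPn[i]] :=
    boolP [forall i, (m i != 0%N) ==> (i \in [set enum_rank v | v in S])].
  by move: mQ; rewrite mcoeff_msupp cS ?eqxx // => i; apply/implyP/mS.
rewrite negb_imply => /andP[mi iS].
rewrite -mul_mpolyC rmorphM idealMr // mpolyXE_id (bigD1 i) //= rmorphM mulrC.
rewrite idealMr // -(prednK (n := m i)) ?lt0n // exprSr rmorphM idealMr //.
apply: contraNT iS => iP; apply/imsetP; exists (enum_val i); last by rewrite enum_valK.
by rewrite inE /vertex_var enum_valK.
Qed.

(** * Lower bound: primes attached to independent sets *)

Definition restrict_vars (K : fieldType) (G : sgraph) (T : {set G}) :
    {rmorphism vertex_ring K G -> vertex_ring K G} :=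
  comp_mpoly [tuple if enum_val i \in T then 'X_i else 0 | i < #|G|].

Lemma restrict_vars_var (K : fieldType) (G : sgraph) (T : {set G}) (v : G) :
  restrict_vars K T (vertex_var K v) = if v \in T then vertex_var K v else 0.
Proof. by rewrite /= comp_mpolyXU -tnth_nth tnth_mktuple enum_rankK. Qed.

(** This makes the kernels of the restrictions grow as [T] shrinks. *)
Lemma restrict_vars_sub (K : fieldType) (G : sgraph) (T T' : {set G})
    (p : vertex_ring K G) :
  T \subset T' -> restrict_vars K T (restrict_vars K T' p) = restrict_vars K T p.
Proof.
move=> /subsetP sub; elim/mpolyind: p => [|c m p _ _ IHp]; first by rewrite !rmorph0.
rewrite !rmorphD IHp /= !comp_mpolyZ; congr (_ *: _ + _).
rewrite mpolyXE_id !rmorph_prod; apply: eq_bigr => i _; rewrite !rmorphXn.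
have -> : 'X_i = vertex_var K (enum_val i) by rewrite /vertex_var enum_valK.
have := restrict_vars_var K T (enum_val i); have := restrict_vars_var K T' (enum_val i).
move=> /= -> ETi; case: ifPn => // iT'; rewrite ETi ifN ?rmorph0 //.
exact: contra (@sub _) iT'.
Qed.

(** Every edge has an endpoint outside [T], so the restriction kills the edge ideal and factors
    through the quotient. *)
Lemma restrict_vars_repr (K : fieldType) (G : sgraph) (T : {set G})
    (p : vertex_ring K G) :
  independent T -> restrict_vars K T (repr (\pi_(edge_ring K G) p)) = restrict_vars K T p.
Proof.
move=> indepT; apply/eqP; rewrite -subr_eq0 -rmorphB.
have : repr (\pi_(edge_ring K G) p) - p \in @edge_ideal K G.
  by rewrite Quotient.idealrBE reprK.
move=> /asboolP[s [sE ->]]; rewrite rmorph_sum big_seq big1 // => c /sE[x [y [xy ->]]].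
rewrite !rmorphM !restrict_vars_var.
case: ifPn => xT; last by rewrite mul0r mulr0.
case: ifPn => yT; last by rewrite !mulr0.
by have := indepT x y xT yT; rewrite xy.
Qed.

(** The ideal generated by the classes of the variables outside [T], presented as a kernel so that
    primality comes from the polynomial ring being a domain. *)
Definition vars_off (K : fieldType) (G : sgraph) (T : {set G})
    (indepT : independent T) : {pred edge_ring K G} :=
  fun x => restrict_vars K T (repr x) == 0.
Arguments vars_off K [G T] indepT.

Lemma vars_off_pi (K : fieldType) (G : sgraph) (T : {set G})
    (indepT : independent T) (p : vertex_ring K G) :
  (\pi_(edge_ring K G) p \in vars_off K indepT) = (restrict_vars K T p == 0).
Proof. by rewrite -(restrict_vars_repr p indepT). Qed.

Lemma vars_off_closed (K : fieldType) (G : sgraph) (T : {set G})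
    (indepT : independent T) : idealr_closed (vars_off K indepT).
Proof.
split.
- by rewrite -(rmorph0 \pi_(edge_ring K G)) vars_off_pi rmorph0.
- by rewrite -(rmorph1 \pi_(edge_ring K G)) vars_off_pi rmorph1 oner_eq0.
- elim/quotP => a _; elim/quotP => u _; elim/quotP => v _.
  rewrite -rmorphM -rmorphD !vars_off_pi rmorphD rmorphM => /eqP -> /eqP ->.
  by rewrite mulr0 addr0.
Qed.

HB.instance Definition _ (K : fieldType) (G : sgraph) (T : {set G})
    (indepT : independent T) :=
  isIdealr.Build (edge_ring K G) (vars_off K indepT) (@vars_off_closed K G T indepT).

Lemma vars_off_prime (K : fieldType) (G : sgraph) (T : {set G})
    (indepT : independent T) : prime_idealr_closed (vars_off K indepT).
Proof.
elim/quotP => u _; elim/quotP => v _.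
by rewrite -rmorphM !vars_off_pi rmorphM mulf_eq0.
Qed.

HB.instance Definition _ (K : fieldType) (G : sgraph) (T : {set G})
    (indepT : independent T) :=
  isPrimeIdealrClosed.Build (edge_ring K G) (vars_off K indepT)
    (@vars_off_prime K G T indepT).

Lemma edge_ring_chain_ex (K : fieldType) (G : sgraph) (S : {set G}) :
  independent S ->
  exists P : 'I_#|S|.+1 -> prime_idealr (edge_ring K G), prime_chain P.
Proof.
(* [T i] drops the first [i] vertices of [S], down to the empty set at [i = #|S|]. *)
move=> indepS; pose T (i : nat) := [set v in S | (i <= index v (enum S))%N].
have indepT i : independent (T i).
  by move=> x y; rewrite !inE => /andP[xS _] /andP[yS _]; exact: indepS.
exists (fun i : 'I__ => vars_off K (indepT i) : prime_idealr _) => i j ij; split.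
  elim/quotP => p _; rewrite !vars_off_pi => /eqP pi.
  rewrite -(@restrict_vars_sub _ _ _ (T i)) ?pi ?rmorph0 //.
  by apply/subsetP => v; rewrite !inE => /andP[-> /(leq_trans (ltnW ij))].
have iS : (i < #|S|)%N by rewrite (leq_trans ij) // -ltnS.
(* The vertex at position [i] is in [T i] but not in [T j], so its variable separates the two
   ideals. *)
have [v vS vi] : exists2 v, v \in S & index v (enum S) = i.
  have [v _] : exists v, v \in S by apply/card_gt0P; apply: leq_trans iS.
  exists (nth v (enum S) i); last by rewrite index_uniq ?enum_uniq -?cardE.
  by rewrite -mem_enum mem_nth -?cardE.
exists (\pi_(edge_ring K G) (vertex_var K v)).
  by rewrite vars_off_pi restrict_vars_var inE vS vi leqNgt ij.
rewrite vars_off_pi restrict_vars_var inE vS vi leqnn /=.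
apply/eqP => /(congr1 (mcoeff U_(enum_rank v))) /eqP.
by rewrite mcoeffXU mcoeff0 eqxx oner_eq0.
Qed.

Lemma krull_dim_edge_ring (K : fieldType) (G : sgraph) (S : {set G}) :
  independent S -> (forall T : {set G}, independent T -> (#|T| <= #|S|)%N) ->
  has_krull_dim (edge_ring K G) #|S|.
Proof.
move=> indepS maxS; split; first exact: edge_ring_chain_ex.
by move=> e P; apply: edge_ring_chain_le.
Qed.

(** * Maximum independent sets of the semiregular tree *)

Lemma tree_word_inj (n k : nat) : injective (@tree_word n k).
Proof. by move=> v w /val_inj /val_inj. Qed.

Lemma size_tree_word (n k : nat) (v : tree_vertex n k) : (size (tree_word v) <= k)%N.
Proof. exact: size_bseq. Qed.

Lemma tree_word_ex (n k : nat) (s : seq 'I_n) :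
  (size s <= k)%N -> all (fun i : 'I_n => (i < n.-1)%N) (behead s) ->
  exists v : tree_vertex n k, tree_word v = s.
Proof. by move=> sk s_all; exists (Sub (Bseq sk : k.-bseq _) s_all). Qed.

Definition alternate_levels (n k : nat) : {set semiregular_tree n k} :=
  [set v | odd (size (tree_word v)) == odd k].

Lemma alternate_levels_independent (n k : nat) : independent (alternate_levels n k).
Proof.
move=> x y; rewrite !inE => /eqP xk /eqP yk; apply/negP => /orP[] /andP[/eqP sz _].
  by move: yk; rewrite sz /= xk; case: (odd k).
by move: xk; rewrite sz /= yk; case: (odd k).
Qed.

(* Sending each vertex of the other levels to one of its children is injective
   on an independent set. *)
Lemma card_independent_tree (n k : nat) (T : {set semiregular_tree n k}) :
  (1 < n)%N -> independent T -> (#|T| <= #|alternate_levels n k|)%N.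
Proof.
move=> n1 indepT; have n0 := ltnW n1; pose z := Ordinal n0.
have /choice[f fP] (v : tree_vertex n k) : exists u : tree_vertex n k,
    if v \in alternate_levels n k then u = v else tree_word u = rcons (tree_word v) z.
  have [vA|vA] := boolP (v \in _); first by exists v.
  (* Leaves have length [k], so a vertex off the alternate levels is not a leaf and has a child. *)
  apply: tree_word_ex.
    rewrite size_rcons ltn_neqAle size_tree_word andbT.
    by apply: contra vA => /eqP sk; rewrite inE sk.
  have := valP v; rewrite -/(tree_word v); case: (tree_word v) => //= a s s_all.
  by rewrite all_rcons s_all andbT /= -ltnS prednK.
have adj_child (v w : tree_vertex n k) :
    tree_word w = rcons (tree_word v) z -> tree_adj v w.
  by move=> vw; rewrite /tree_adj /child_of vw size_rcons eqxx prefix_rcons.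
rewrite -(card_in_imset (f := f) (D := T)).
  apply/subset_leq_card/subsetP => _ /imsetP[v vT ->].
  have := fP v; case: ifPn => [vA -> //|]; rewrite !inE => vA ->.
  by rewrite size_rcons /=; move: vA; do 2!case: odd.
move=> v w vT wT fvw; have := fP v; have := fP w; rewrite -fvw.
(* In the two mixed cases one vertex is a child of the other, against independence. *)
case: ifPn => _ Ew; case: ifPn => _ Ev.
- by rewrite -Ev Ew.
- by have := indepT _ _ vT wT; rewrite /= adj_child // -Ew.
- by have := indepT _ _ wT vT; rewrite /= adj_child // -Ev.
- by apply: tree_word_inj; move: Ew; rewrite Ev => /rcons_inj[].
Qed.

(* Prefixing the extra letter available at the root, when needed to correct the
   parity, identifies the words of length at most [k] on [n - 1] letters with
   the vertices of the alternate levels. *)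
Lemma card_alternate_levels (n k : nat) :
  (0 < n)%N -> #|alternate_levels n k| = (\sum_(i < k.+1) (n - 1) ^ i)%N.
Proof.
case: n => // m _; rewrite subn1 /=.
rewrite (eq_bigr (fun i : 'I_k.+1 => #|'I_m| ^ i)%N) => [|i _]; last by rewrite card_ord.
rewrite -card_bseq; pose up := map (widen_ord (leqnSn m)).
have up_inj : injective up by apply: inj_map => i j /(congr1 val) /= /val_inj.
have up_all s : all (fun i : 'I_m.+1 => (i < m)%N) (up s).
  by apply/allP => _ /mapP[i _ ->]; exact: (ltn_ord i).
have up_ex s : all (fun i : 'I_m.+1 => (i < m)%N) s -> exists w, s = up w.
  elim: s => [_|i s IHs /= /andP[im /IHs[w ->]]]; first by exists [::].
  by exists (Ordinal im :: w); congr (_ :: _); apply: val_inj.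
have /choice[h hP] (w : {bseq k of 'I_m}) : exists v : tree_vertex m.+1 k,
    tree_word v = if odd (size w) == odd k then up w else ord_max :: up w.
  apply: tree_word_ex.
    (* A word of the wrong parity is shorter than [k], which leaves room for the extra letter. *)
    have wk := size_bseq w; case: ifPn => [_|par]; rewrite /= size_map //.
    by rewrite ltn_neqAle wk andbT; apply: contra par => /eqP ->.
  case: ifPn => _ /=; last exact: up_all.
  case: (w : seq _) (up_all w) => //= i s /andP[].
have h_inj : injective h.
  (* [up] never produces [ord_max], so the two shapes of image word stay apart. *)
  have max_up s s' : ord_max :: up s = up s' -> False.
    by move=> E; have := up_all s'; rewrite -E /= ltnn.
  move=> w w' /(congr1 (@tree_word _ _)); rewrite !hP.
  by do 2!case: ifPn => _; [|case/esym/max_up|case/max_up|case] => // /up_inj /val_inj.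
rewrite -(card_imset _ h_inj); apply: eq_card => v; apply/idP/imsetP.
  rewrite inE => vA; have vk := size_tree_word v; have := valP v.
  (* A vertex word has [ord_max] at most in first position; stripping it there gives the
     preimage. *)
  rewrite -/(tree_word v); have [v_all _|v_all b_all] :=
    boolP (all (fun i : 'I_m.+1 => (i < m)%N) (tree_word v)).
    have [w vw] := up_ex _ v_all; move: vA vk; rewrite vw size_map => wA wk.
    by exists (Bseq wk : k.-bseq _) => //; apply: tree_word_inj; rewrite hP /= wA.
  have [w vw] : exists w, tree_word v = ord_max :: up w.
    case: (tree_word v) v_all b_all => //= a s as_all s_all; have [w sw] := up_ex _ s_all.
    exists w; rewrite -sw; congr (_ :: _); apply: val_inj => /=.
    move: as_all; rewrite s_all andbT -leqNgt => ma.
    by apply/eqP; rewrite eqn_leq ma -ltnS ltn_ord.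
  move: vA vk; rewrite vw /= size_map => wA wk.
  exists (Bseq (ltnW wk) : k.-bseq _) => //; apply: tree_word_inj; rewrite hP /= vw.
  by move: wA; do 2!case: odd.
move=> [w _ ->]; rewrite inE hP; case: ifPn => /=; rewrite size_map //.
by do 2!case: odd.
Qed.

Local Close Scope ring_scope.

Theorem theorem3p4 (K : fieldType) (n k : nat) (hn : 3 <= n) (hk : 1 <= k) :
  has_krull_dim (edge_ring K (semiregular_tree n k))
    (((n - 1) ^ k.+1 - 1) %/ (n - 2)).
Proof.
have n1 : (1 < n)%N by apply: ltnW.
have -> : ((n - 1) ^ k.+1 - 1) %/ (n - 2) = #|alternate_levels n k|.
  (* Geometric sum of ratio [n - 1], with [n - 2] nonzero. *)
  rewrite card_alternate_levels ?(ltnW n1) // (subn1 (_ ^ _)) predn_exp -subn1 -subnDA.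
  by rewrite mulKn // subn_gt0.
apply: krull_dim_edge_ring; first exact: alternate_levels_independent.
by move=> T; apply: card_independent_tree.
Qed.
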